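(* Let $(X,d,f)$ be a TDS and $\varphi\in C(X,\mathbb R)$ with $\varphi>0$. Let $K\subset X$ be a non-empty compact subset. Then for every $\alpha\ge0$, $$\dim^\alpha_{BS}(f,K,\varphi)=\sup\{P^\alpha_\mu(f,\varphi):\mu\in\mathcal M(X),\ \mu(K)=1\}.$$
   Context: A TDS $(X,d,f)$ consists of a compact metric space $(X,d)$ and a continuous map $f:X\to X$; $\mathcal M(X)$ is the set of Borel probability measures on $X$. $S_n\varphi(x)=\sum_{j=0}^{n-1}\varphi(f^jx)$. For $\alpha\ge0$: $d_n^\alpha(x,y)=\max_{0\le i\le n-1}e^{\alpha i}d(f^ix,f^iy)$, $B_n^\alpha(x,\varepsilon)=\{y: d_n^\alpha(x,y)<\varepsilon\}$. $\alpha$-BS dimension: for $K\subset X$, $\varepsilon>0$, $s\ge0$, $n\in\mathbb N$, continuous $\varphi>0$, $M^\alpha(K,s,\varepsilon,n,\varphi)=\inf\sum_i\exp\big(-s\sup_{y\in B^\alpha_{n_i}(x_i,\varepsilon)}S_{n_i}\varphi(y)\big)$ over finite or countable families $\{B^\alpha_{n_i}(x_i,\varepsilon)\}$, $x_i\in X$, $n_i\ge n$, covering $K$; $M^\alpha(K,s,\varepsilon,\varphi)=\lim_n M^\alpha(K,s,\varepsilon,n,\varphi)$; $M^\alpha(K,\varepsilon,\varphi)=\inf\{s:M^\alpha(K,s,\varepsilon,\varphi)=0\}=\sup\{s:M^\alpha(K,s,\varepsilon,\varphi)=\infty\}$; $\dim^\alpha_{BS}(f,K,\varphi)=\lim_{\varepsilon\to0}M^\alpha(K,\varepsilon,\varphi)$.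 $\alpha$-local Brin–Katok entropy: for $\mu\in\mathcal M(X)$, $P^\alpha_\mu(f,x,\varphi)=\lim_{\varepsilon\to0}\liminf_{n\to\infty}\frac{-\log\mu(B_n^\alpha(x,\varepsilon))}{S_n\varphi(x)}$ and $P^\alpha_\mu(f,\varphi)=\int P^\alpha_\mu(f,x,\varphi)\,d\mu(x)$. *)

(* Defs.v *)
From HB Require Import structures.
From mathcomp Require Import all_boot all_order all_algebra.
From mathcomp Require Import all_classical all_reals all_analysis.

Set Implicit Arguments.
Unset Strict Implicit.
Unset Printing Implicit Defensive.

Import Order.TTheory GRing.Theory Num.Theory.
Import numFieldNormedType.Exports.

Local Open Scope classical_set_scope.
Local Open Scope ring_scope.

(* A (nonempty, i.e. pointed) metric space; the point is only needed so that the
   Borel sigma-algebra can be packaged as a measurableType (which requires a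
   pointedType).  Nonemptiness is implied by the hypothesis K != set0. *)
#[short(type="pointedMetricType")]
HB.structure Definition PointedMetric (K : numDomainType) :=
  {M of Pointed M & Metric K M}.

Section TDS.
Context {R : realType} {X : pointedMetricType R}.

Definition borel_of : measurableType (@open X).-sigma := g_sigma_algebraType (@open X).

Definition birkhoff (f : X -> X) (phi : X -> R) (n : nat) (x : X) : R :=
  \sum_(0 <= j < n) phi (iter j f x).

Definition dn_alpha (f : X -> X) (alpha : R) (n : nat) (x y : X) : R :=
  \big[Num.max/0]_(i < n) (expR (alpha * i%:R) * mdist (iter i f x) (iter i f y)).

Definition bowen_ball (f : X -> X) (alpha : R) (n : nat) (x : X) (eps : R)
  : set X := [set y | dn_alpha f alpha n x y < eps].

(* A (finite or countable) family of Bowen balls {B_{n_i}^alpha(x_i,eps)}_{i in I},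
   indexed by a subset I of nat, with n_i >= N, covering K. *)
Definition bowen_cover (f : X -> X) (alpha : R) (K : set X) (eps : R) (N : nat)
  (I : set nat) (xs : nat -> X) (ns : nat -> nat) : Prop :=
  (forall i, I i -> (N <= ns i)%N) /\
  K `<=` \bigcup_(i in I) bowen_ball f alpha (ns i) (xs i) eps.

Definition ball_weight (f : X -> X) (phi : X -> R) (alpha s eps : R)
  (n : nat) (x : X) : \bar R :=
  (expR (- s * sup [set birkhoff f phi n y | y in bowen_ball f alpha n x eps]))%:E.

Definition M_N (f : X -> X) (phi : X -> R) (alpha : R) (K : set X)
  (s eps : R) (N : nat) : \bar R :=
  ereal_inf [set \esum_(i in c.1.1) ball_weight f phi alpha s eps (c.2 i) (c.1.2 i)
            | c in [set c : set nat * (nat -> X) * (nat -> nat)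
                   | bowen_cover f alpha K eps N c.1.1 c.1.2 c.2]].

Definition M_s (f : X -> X) (phi : X -> R) (alpha : R) (K : set X)
  (s eps : R) : \bar R :=
  limn (fun N => M_N f phi alpha K s eps N).

Definition M_crit (f : X -> X) (phi : X -> R) (alpha : R) (K : set X)
  (eps : R) : \bar R :=
  ereal_inf [set s%:E | s in [set s : R | 0 <= s /\ M_s f phi alpha K s eps = 0%E]].

Definition dim_BS (f : X -> X) (alpha : R) (K : set X) (phi : X -> R) : \bar R :=
  lim (M_crit f phi alpha K eps @[eps --> 0^'+]).

Definition local_BK (mu : probability borel_of R) (f : X -> X) (alpha : R)
  (x : X) (phi : X -> R) : \bar R :=
  lim ((limn_einf (fun n =>
         (- lne (mu (bowen_ball f alpha n x eps)))
         * ((birkhoff f phi n x)^-1)%:E)%E) @[eps --> 0^'+]).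

Definition BK_entropy (mu : probability borel_of R) (f : X -> X) (alpha : R)
  (phi : X -> R) : \bar R :=
  (\int[mu]_x local_BK mu f alpha x phi)%E.

End TDS.

(* Main.v *)
(* Lower bound. If [mu] gives the Bowen balls around the points of [A] mass at
   most [exp (- s S_n phi)], then a cover of [A] by slightly smaller Bowen balls
   of small total weight (for a smaller exponent) has small [mu]-measure, the
   oscillation of [phi] on those balls being absorbed by the gap between the
   exponents. Hence the local entropy is at most the dimension [mu]-a.e.

   Upper bound. Below the critical exponent a Frostman measure is needed. The
   least cost of a finite weighted family of Bowen balls dominating a bounded
   function on [K] is a sublinear functional; Hahn-Banach gives a linear
   functional below it, that is, a finitely additive measure on all subsets of
   [X] for which each Bowen ball is light. Its regularization from inside by
   closed sets and from outside by open sets is a Borel probability measure that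
   does not increase the mass of open sets, such as Bowen balls. The dominating
   cost of [1] is positive since a weighted cover can be thinned out, level by
   level, to an honest cover by balls of twice the radius. *)

Require Import Defs.
From HB Require Import structures.
From mathcomp Require Import all_boot all_order all_algebra.
From mathcomp Require Import all_classical all_reals all_analysis.
From mathcomp Require Import lra ring.

Import Order.TTheory GRing.Theory Num.Theory.
Import numFieldNormedType.Exports.

Local Open Scope classical_set_scope.
Local Open Scope ring_scope.

Set Implicit Arguments.
Unset Strict Implicit.
Unset Printing Implicit Defensive.

(** * Hahn-Banach theorem *)

Definition sublinear {R : realType} {V : lmodType R} (p : V -> R) :=
  (forall x y, p (x + y) <= p x + p y) /\
  (forall a x, 0 <= a -> p (a *: x) <= a * p x).

Section hahn_banach.
Context {R : realType} {V : lmodType R}.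
Implicit Types p q : V -> R.

Lemma sublinear0 p : sublinear p -> p 0 = 0.
Proof.
move=> [pD pZ]; apply/eqP; rewrite eq_le; apply/andP; split.
  by have := pZ 0 0 (lexx _); rewrite scale0r mul0r.
by have := pD 0 0; rewrite addr0 lerDr.
Qed.

Lemma sublinearZ p a x : sublinear p -> 0 <= a -> p (a *: x) = a * p x.
Proof.
move=> sp; rewrite le_eqVlt => /predU1P[<-|a0].
  by rewrite scale0r mul0r sublinear0.
apply/eqP; rewrite eq_le sp.2 ?(ltW a0)//= -ler_pdivlMl//.
have -> : p x = p (a^-1 *: (a *: x)).
  by rewrite scalerA mulVf ?gt_eqF// scale1r.
by apply: sp.2; rewrite invr_ge0 ltW.
Qed.

Lemma sublinear_geN p x : sublinear p -> - p (- x) <= p x.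
Proof.
move=> sp; rewrite lerNl -subr_ge0 opprK addrC.
by rewrite -(sublinear0 sp) -(subrr x) sp.1.
Qed.

Definition descent q (y x : V) : R :=
  inf [set q (x + t *: y) - t * q y | t in [set t | 0 <= t]].

Lemma descent_le q y x t : sublinear q -> 0 <= t ->
  descent q y x <= q (x + t *: y) - t * q y.
Proof.
move=> sq t0; apply: ge_inf; last by exists t.
exists (- q (- x)) => _ [u /= u0 <-]; rewrite lerBrDl -(sublinearZ y sq)// lerBlDr.
by have := sq.1 (x + u *: y) (- x); rewrite addrAC subrr add0r.
Qed.

Lemma le_descent q y x c :
  (forall t, 0 <= t -> c <= q (x + t *: y) - t * q y) -> c <= descent q y x.
Proof.
move=> h; apply: lb_le_inf; first by exists (q (x + 0 *: y) - 0 * q y), 0 => /=.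
by move=> _ [t /= t0 <-]; exact: h.
Qed.

Lemma descent_le_id q y x : sublinear q -> descent q y x <= q x.
Proof.
move=> sq; have := descent_le y x sq (lexx _).
by rewrite scale0r mul0r subr0 addr0.
Qed.

(** Parameters [t] and [u] chosen for two arguments combine to [t + u]; scaling the argument by [a]
    scales the parameter to [a * t]. *)
Lemma sublinear_descent q y : sublinear q -> sublinear (descent q y).
Proof.
move=> sq; split=> [x z|a x a0].
  rewrite -lerBlDr; apply: le_descent => t t0.
  rewrite lerBlDr -lerBlDl; apply: le_descent => u u0.
  rewrite lerBlDl; apply: (le_trans (@descent_le q y (x + z) (t + u) sq _)).
    exact: addr_ge0.
  have -> : x + z + (t + u) *: y = (x + t *: y) + (z + u *: y).
    by rewrite scalerDl addrACA.
  have := sq.1 (x + t *: y) (z + u *: y); lra.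
have key t : 0 <= t -> descent q y (a *: x) <= a * (q (x + t *: y) - t * q y).
  move=> t0; apply: (le_trans (@descent_le q y (a *: x) (a * t) sq _)).
    exact: mulr_ge0.
  rewrite -scalerA -scalerDr mulrBr mulrA lerD2r; exact: sq.2.
move: a0; rewrite le_eqVlt => /predU1P[a0|a0].
  by have := key 0 (lexx _); rewrite -a0 !mul0r.
rewrite mulrC -ler_pdivrMr//; apply: le_descent => t t0.
by rewrite ler_pdivrMr// mulrC; exact: key.
Qed.

(* Minimality forces [descent q y = q], which says that [q] is additive. *)
Lemma minimal_sublinear_additive q : sublinear q ->
  (forall q', sublinear q' -> (forall x, q' x <= q x) -> q' = q) ->
  forall x y, q (x + y) = q x + q y.
Proof.
move=> sq minq x y; apply/eqP; rewrite eq_le sq.1 /=.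
have dq : descent q y = q.
  by apply: minq => [|z]; [exact: sublinear_descent|exact: descent_le_id].
have := descent_le y x sq ler01.
by rewrite dq scale1r mul1r lerBrDr.
Qed.

(** Zorn's lemma: the pointwise infimum of a chain is finite, since every sublinear [s] below [p]
    satisfies [- p (- x) <= - s (- x) <= s x]. *)
Lemma exists_minimal_sublinear p : sublinear p ->
  exists q, [/\ sublinear q, forall x, q x <= p x &
    forall q', sublinear q' -> (forall x, q' x <= q x) -> q' = q].
Proof.
move=> sp; pose T := {q | sublinear q /\ forall x, q x <= p x}.
(* The order is reversed, so that a maximal element is a minimal functional. *)
pose below (s t : T) := `[< forall x, sval t x <= sval s x >].
have [||||[q [sq qp]] qmax] := @Zorn T below.
- by move=> t; apply/asboolP.
- move=> r s t /asboolP rs /asboolP st; apply/asboolP => x.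
  exact: le_trans (st x) (rs x).
- move=> [s ?] [t ?] /asboolP/= st /asboolP/= ts; apply: eq_exist => /=.
  by apply/funext => x; apply/eqP; rewrite eq_le st ts.
- move=> A totA; have [[s0 As0]|A0] := pselect (A !=set0); last first.
    exists (exist _ p (conj sp (fun=> lexx _))) => s As.
    by exfalso; apply: A0; exists s.
  pose m x := inf [set sval s x | s in A].
  have mle x s : A s -> m x <= sval s x.
    move=> As; apply: ge_inf; last by exists s.
    exists (- p (- x)) => _ [[t [st tp]] _ <-] /=.
    by apply: le_trans (sublinear_geN x st); rewrite lerN2.
  have m_ge x c : (forall s, A s -> c <= sval s x) -> c <= m x.
    move=> h; apply: lb_le_inf; first by exists (sval s0 x), s0.
    by move=> _ [s As <-]; exact: h.
  suff sm : sublinear m /\ forall x, m x <= p x.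
    by exists (exist _ m sm) => s As; apply/asboolP => x /=; exact: mle.
  split; last by move=> x; apply: le_trans (mle x s0 As0) _; case: s0 {As0} => ? [].
  split=> [x y|a x a0].
    rewrite -lerBlDr; apply: (m_ge x) => s As; rewrite lerBlDr -lerBlDl.
    apply: (m_ge y) => t At; rewrite lerBlDl.
    (* The smaller of two members of the chain serves at both [x] and [y]; this is how totality
       gives subadditivity. *)
    have [/asboolP st|/asboolP ts] := totA s t As At.
      apply: le_trans (mle _ _ At) _.
      by apply: le_trans ((svalP t).1.1 x y) _; rewrite lerD2r.
    apply: le_trans (mle _ _ As) _.
    by apply: le_trans ((svalP s).1.1 x y) _; rewrite lerD2l.
  have key s : A s -> m (a *: x) <= a * sval s x.
    by move=> As; apply: le_trans (mle _ _ As) _; exact: (svalP s).1.2.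
  move: a0; rewrite le_eqVlt => /predU1P[a0|a0].
    by have := key _ As0; rewrite -a0 !mul0r.
  rewrite mulrC -ler_pdivrMr//; apply: (m_ge x) => s As.
  by rewrite ler_pdivrMr// mulrC; exact: key.
- exists q; split => // q' sq' q'q.
  have q'p : sublinear q' /\ forall x, q' x <= p x.
    by split => // x; exact: le_trans (q'q x) (qp x).
  have /qmax : below (exist _ q (conj sq qp)) (exist _ q' q'p) by apply/asboolP.
  by move=> /(congr1 sval).
Qed.

(** The minimal functional is taken below [descent p x0] instead of [p]: this forces
    [q (- x0) <= - p x0], hence [q x0 = p x0] by additivity. *)
Theorem hahn_banach p x0 : sublinear p ->
  exists L : V -> R, [/\ forall x y, L (x + y) = L x + L y,
    forall a x, L (a *: x) = a * L x, forall x, L x <= p x & L x0 = p x0].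
Proof.
move=> sp; have sd := sublinear_descent x0 sp.
have [q [sq qd qmin]] := exists_minimal_sublinear sd.
have qD := minimal_sublinear_additive sq qmin.
have qN x : q (- x) = - q x.
  by apply/eqP; rewrite -addr_eq0 -qD addNr sublinear0.
have qp x : q x <= p x := le_trans (qd x) (descent_le_id x0 x sp).
exists q; split => //.
  move=> a x; have [a0|a0] := leP 0 a; first exact: sublinearZ.
  apply: oppr_inj; rewrite -qN -scaleNr sublinearZ ?mulNr//.
  by rewrite oppr_ge0 ltW.
apply/eqP; rewrite eq_le qp /= -lerN2 -qN.
apply: (le_trans (qd _)); apply: (le_trans (descent_le x0 (- x0) sp ler01)).
by rewrite scale1r addNr sublinear0// mul1r sub0r.
Qed.

End hahn_banach.

(** * Finitely additive Frostman lemma *)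

Section bounded_functions.
Context {R : realType} {T : Type}.

Definition bounded_function : {pred T -> R} :=
  [pred g : T -> R | `[< exists M, forall x, `|g x| <= M >]].

Fact bounded_function_submod_closed : submod_closed bounded_function.
Proof.
split=> [|a g h /asboolP[M gM] /asboolP[N hN]].
  by apply/asboolP; exists 0 => x; rewrite normr0.
apply/asboolP; exists (`|a| * M + N) => x.
apply: (le_trans (ler_normD _ _)); rewrite lerD// normrM.
by rewrite ler_wpM2l.
Qed.

HB.instance Definition _ := GRing.isSubmodClosed.Build R (T -> R)
  bounded_function bounded_function_submod_closed.

(** Packaged as a module so that [hahn_banach] applies; it contains the indicators of all subsets,
    measurable or not. *)
Definition bfun := {g : T -> R | bounded_function g}.
HB.instance Definition _ := SubChoice.on bfun.
HB.instance Definition _ := [SubChoice_isSubLmodule of bfun by <:].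

Fact bounded_indic (A : set T) : bounded_function (\1_A : T -> R).
Proof.
apply/asboolP; exists 1 => x.
by rewrite indicE ger0_norm ?ler0n// lern1 leq_b1.
Qed.

Definition bindic (A : set T) : bfun := Sub (\1_A : T -> R) (bounded_indic A).

End bounded_functions.

Section weighted_families.
Context {R : realType} {T I : Type} (B : I -> set T) (w : I -> R).
Implicit Types s t : seq (R * I).

(** A finite weighted family is encoded as a list of pairs of a weight and an index into [B],
    repetitions allowed. *)
Definition nonneg_family s := all (fun i => 0 <= i.1) s.

Definition load s (x : T) : R := \sum_(i <- s) i.1 * \1_(B i.2) x.

Definition cost s : R := \sum_(i <- s) i.1 * w i.2.

Definition rescale (a : R) s := [seq (a * i.1, i.2) | i <- s].

Lemma nonneg_rescale a s : 0 <= a -> nonneg_family s ->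
  nonneg_family (rescale a s).
Proof.
move=> a0 s0; rewrite /nonneg_family all_map.
by apply: sub_all s0 => i /= i0; rewrite mulr_ge0.
Qed.

Lemma load_rescale a s x : load (rescale a s) x = a * load s x.
Proof.
rewrite /load big_map mulr_sumr.
by apply: eq_bigr => i _; rewrite /= mulrA.
Qed.

Lemma cost_rescale a s : cost (rescale a s) = a * cost s.
Proof.
rewrite /cost big_map mulr_sumr.
by apply: eq_bigr => i _; rewrite /= mulrA.
Qed.

Lemma load_cat s t x : load (s ++ t) x = load s x + load t x.
Proof. by rewrite /load big_cat. Qed.

Lemma cost_cat s t : cost (s ++ t) = cost s + cost t.
Proof. by rewrite /cost big_cat. Qed.

Hypothesis w_ge0 : forall i, 0 <= w i.

Lemma cost_ge0 s : nonneg_family s -> 0 <= cost s.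
Proof.
rewrite /cost; elim: s => [|i s IHs] /=; first by rewrite big_nil.
by case/andP => i0 s0; rewrite big_cons addr_ge0 ?IHs// mulr_ge0.
Qed.

Variables (K : set T).

Definition dominates s (g : T -> R) :=
  nonneg_family s /\ forall x, K x -> g x <= load s x.

(** [g] may be negative and is dominated on [K] only, so the empty family bounds the cost by 0
    whenever [g <= 0] on [K]. *)
Definition domination_cost (g : @bfun R T) : R :=
  inf [set cost s | s in [set s | dominates s (val g)]].

Lemma domination_cost_le s (g : @bfun R T) : dominates s (val g) ->
  domination_cost g <= cost s.
Proof.
move=> sg; apply: ge_inf; last by exists s.
by exists 0 => _ [t [t0 _] <-]; exact: cost_ge0.
Qed.

Hypothesis K_loaded : exists s, dominates s (cst 1).

(** The infimum runs over a nonempty set, which rules out the default value of [inf]: a family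
    dominating 1, rescaled by a bound of [|g|], dominates [g]. *)
Lemma le_domination_cost c (g : @bfun R T) :
  (forall s, dominates s (val g) -> c <= cost s) -> c <= domination_cost g.
Proof.
move=> h; apply: lb_le_inf; last by move=> _ [s sg <-]; exact: h.
have [s [s0 s1]] := K_loaded.
have /asboolP[M gM] := valP g; exists (cost (rescale `|M| s)), (rescale `|M| s) => //.
split; first exact: nonneg_rescale.
move=> x Kx; rewrite load_rescale (le_trans (ler_norm _))//.
rewrite (le_trans (gM x))// (le_trans (ler_norm _))// ler_peMr//.
exact: s1.
Qed.

Lemma sublinear_domination_cost : sublinear domination_cost.
Proof.
split=> [g h|a g a0].
  rewrite -lerBlDr; apply: le_domination_cost => s [s0 sg].
  rewrite lerBlDr -lerBlDl; apply: le_domination_cost => t [t0 th].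
  rewrite lerBlDl -cost_cat; apply: domination_cost_le; split.
    by rewrite /nonneg_family all_cat; apply/andP.
  by move=> x Kx; rewrite load_cat; apply: lerD; [exact: sg|exact: th].
have key s : dominates s (val g) -> domination_cost (a *: g) <= a * cost s.
  move=> [s0 sg]; rewrite -cost_rescale; apply: domination_cost_le.
  split=> [|x Kx]; first exact: nonneg_rescale.
  by rewrite load_rescale; apply: ler_wpM2l => //; exact: sg.
move: a0 key; rewrite le_eqVlt => /predU1P[<- _|a0 key].
  rewrite mul0r scale0r; have <- : cost [::] = 0 by rewrite /cost big_nil.
  by apply: domination_cost_le; split=> // x _; rewrite /load big_nil.
rewrite mulrC -ler_pdivrMr//; apply: le_domination_cost => s sg.
by rewrite ler_pdivrMr// mulrC; exact: key.
Qed.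

End weighted_families.

Definition fin_additive {R : realType} {T : Type} (lam : set T -> R) :=
  (forall A, 0 <= lam A) /\
  (forall A A', A `&` A' = set0 -> lam (A `|` A') = lam A + lam A').

(** [hahn_banach] at the constant 1 gives [L] below the domination cost with [L 1 >= c]. Comparison
    with the empty family makes [L] positive and concentrated on [K]; the one-member family [(1, i)]
    bounds [L] on [B i] by [w i]. Then [L] is normalized. *)
Theorem weighted_frostman {R : realType} {T I : Type} (B : I -> set T)
    (w : I -> R) (K : set T) (c : R) :
  (forall i, 0 <= w i) -> 0 < c -> (exists s : seq (R * I), dominates B K s (cst 1)) ->
  (forall s : seq (R * I), dominates B K s (cst 1) -> c <= cost w s) ->
  exists lam : set T -> R, [/\ fin_additive lam, lam setT = 1,
    lam (~` K) = 0 & forall i, lam (B i) <= w i / c].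
Proof.
move=> w0 c0 Kcov cle.
have [L [LD LZ Lp L1]] := hahn_banach (bindic setT)
  (sublinear_domination_cost w0 Kcov).
have LN g : L (- g) = - L g by rewrite -scaleN1r LZ mulN1r.
have cL : c <= L (bindic setT).
  rewrite L1; apply: le_domination_cost => // s [s0 s1]; apply: cle; split=> // x Kx.
  by apply: le_trans (s1 x Kx); rewrite /= indicT.
have L0 : 0 < L (bindic setT) := lt_le_trans c0 cL.
have Lneg (g : @bfun R T) : (forall x, K x -> val g x <= 0) -> L g <= 0.
  move=> g0; apply: (le_trans (Lp _)).
  have <- : cost w [::] = 0 by rewrite /cost big_nil.
  by apply: domination_cost_le => //; split=> // x /g0; rewrite /load big_nil.
have Lpos A : 0 <= L (bindic A).
  by rewrite -oppr_le0 -LN; apply: Lneg => x _; rewrite /= oppr_le0 indicE.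
exists (fun A => L (bindic A) / L (bindic setT)); split.
- split=> [A|A A' AA']; first by rewrite divr_ge0// ltW.
  rewrite -mulrDl -LD; congr (L _ / _); apply: val_inj.
  apply/funext => x; have : ~ (A `&` A') x by rewrite AA'.
  rewrite /= addrfctE !indicE in_setU.
  case: (boolP (x \in A)) => [/set_mem Ax|_];
    case: (boolP (x \in A')) => [/set_mem A'x|_];
    by rewrite ?addr0 ?add0r//; case.
- by rewrite /= divff ?gt_eqF.
- suff -> : L (bindic (~` K)) = 0 by rewrite mul0r.
  apply/eqP; rewrite eq_le Lpos andbT; apply: Lneg => x Kx /=.
  by rewrite indicE memNset//.
- move=> i /=; apply: ler_pM => //; rewrite ?invr_ge0 ?(ltW L0)//; last first.
    by rewrite lef_pV2.
  apply: (le_trans (Lp _)).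
  have <- : cost w [:: (1, i)] = w i by rewrite /cost big_seq1 mul1r.
  apply: domination_cost_le => //; split => [|x _] /=.
    by rewrite ler01.
  by rewrite /load big_seq1 mul1r.
Qed.

(** * Borel measures from finitely additive ones *)

Section borel_regularization.
Context {R : realType} {X : pointedMetricType R}.
Variable lam : set X -> R.
Hypothesis lamP : fin_additive lam.

Lemma fin_additive0 : lam set0 = 0.
Proof.
have := lamP.2 set0 set0; rewrite setI0 setU0 => /(_ erefl)/eqP.
by rewrite -subr_eq0 opprD addNKr oppr_eq0 => /eqP.
Qed.

Lemma le_fin_additive A A' : A `<=` A' -> lam A <= lam A'.
Proof.
by move=> AA'; rewrite -(setDUK AA') lamP.2 ?lerDl ?lamP.1// setDIK.
Qed.

Lemma fin_additiveU_le A A' : lam (A `|` A') <= lam A + lam A'.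
Proof.
have -> : A `|` A' = A `|` (A' `\` A).
  by rewrite setUDr setDv setD0.
by rewrite lamP.2 ?setDIK// lerD2l; apply: le_fin_additive => x [].
Qed.

Lemma fin_additive_bigsetU_le n (F : nat -> set X) :
  lam (\big[setU/set0]_(i < n) F i) <= \sum_(i < n) lam (F i).
Proof.
elim: n => [|n IHn]; first by rewrite !big_ord0 fin_additive0.
by rewrite !big_ord_recr /= (le_trans (fin_additiveU_le _ _))// lerD2r.
Qed.

Definition inner_content (U : set X) : R :=
  sup [set lam C | C in [set C | closed C /\ C `<=` U]].

Lemma inner_content_ge C U : closed C -> C `<=` U -> lam C <= inner_content U.
Proof.
move=> cC CU; apply: ub_le_sup; last by exists C.
by exists (lam U) => _ [D [_ DU] <-]; exact: le_fin_additive.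
Qed.

Lemma inner_content_le U c : (forall C, closed C -> C `<=` U -> lam C <= c) ->
  inner_content U <= c.
Proof.
move=> h; apply: ge_sup; last by move=> _ [C [cC CU] <-]; exact: h.
by exists (lam set0), set0 => //; split; [exact: closed0|exact: sub0set].
Qed.

Lemma inner_content_ge0 U : 0 <= inner_content U.
Proof. by rewrite -fin_additive0; apply: inner_content_ge => //; exact: closed0. Qed.

Lemma inner_content_mono U V : U `<=` V -> inner_content U <= inner_content V.
Proof.
move=> UV; apply: inner_content_le => C cC CU.
by apply: inner_content_ge => //; exact: subset_trans UV.
Qed.

Hypothesis cptX : compact [set: X].

(** Finitely many closed balls cover [C], each inside some [U i] even at twice the radius; [D i]
    collects those assigned to [i]. *)
Lemma finite_closed_refinement (C : set X) (U : nat -> set X) :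
  closed C -> (forall i, open (U i)) -> C `<=` \bigcup_i U i ->
  exists (k : nat) (D : nat -> set X), [/\ forall i, closed (D i),
    forall i, D i `<=` U i & C `<=` \bigcup_(i < k) D i].
Proof.
move=> cC oU CU.
have : compact C by apply: subclosed_compact cptX _.
rewrite compact_cover.
pose P := [set d : X * nat * R | 0 < d.2 /\ ball d.1.1 d.2 `<=` U d.1.2].
move=> /(_ _ P (fun d => (closed_ball d.1.1 (d.2 / 2))°)) [].
- by move=> d _; exact: open_interior.
- move=> x /CU[i _ Uix].
  have /nbhs_ballP[r /= r0 rU] := open_nbhs_nbhs (conj (oU i) Uix).
  exists (x, i, r) => //=; apply: filterS (@subset_closure _ _) _.
  by apply: nbhsx_ballx; rewrite divr_gt0.
move=> D' D'P CD'; pose s : seq (X * nat * R) := finmap.enum_fset D'.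
have sP d : d \in s -> P d by move=> ds; apply/set_mem; exact: D'P.
(* One more than the largest index used, so that every chosen ball belongs to some [D i] with
   [i < k]. *)
exists (\max_(d <- s) d.1.2).+1.
exists (fun i => \bigcup_(d in [set d : X * nat * R | d \in s /\ d.1.2 = i])
  closed_ball d.1.1 (d.2 / 2)); split.
- move=> i; apply: closed_bigcup => [|d _]; last exact: closed_ball_closed.
  by apply: (@sub_finite_set _ _ [set` s]) => // d [].
- move=> i x [d [/sP[d0 dU] <-] xd]; apply: dU.
  exact: subset_closure_half xd.
- move=> x /CD'[d dD' /interior_subset xd].
  exists d.1.2; last by exists d.
  by rewrite /= ltnS; exact: (@leq_bigmax_seq _ s xpredT (fun d => d.1.2) d).
Qed.

(** A closed subset of the union is covered by finitely many closed pieces, each in its own [U i],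
    so finite subadditivity of [lam] is enough. *)
Lemma inner_content_bigcup (U : nat -> set X) : (forall i, open (U i)) ->
  ((inner_content (\bigcup_i U i))%:E <= \sum_(i <oo) (inner_content (U i))%:E)%E.
Proof.
move=> oU; set S := (X in (_ <= X)%E).
have S0 : (0 <= S)%E by apply: nneseries_ge0 => i _ _; rewrite lee_fin inner_content_ge0.
have key C : closed C -> C `<=` \bigcup_i U i -> ((lam C)%:E <= S)%E.
  move=> cC /(finite_closed_refinement cC oU)[k [D [cD DU CD]]].
  apply: (@le_trans _ _ (\sum_(0 <= i < k) (inner_content (U i))%:E)%E); last first.
    by apply: nneseries_lim_ge => i _ _; rewrite lee_fin inner_content_ge0.
  rewrite bigcup_mkord in CD.
  rewrite sumEFin lee_fin big_mkord (le_trans (le_fin_additive CD))//.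
  rewrite (le_trans (fin_additive_bigsetU_le _ _))//; apply: ler_sum => i _.
  exact: inner_content_ge.
case: S S0 key => [r||] //= _ key; last by rewrite leey.
by rewrite lee_fin; apply: inner_content_le => C cC /(key C cC); rewrite lee_fin.
Qed.

Definition outer_content (A : set X) : R :=
  inf [set inner_content U | U in [set U | open U /\ A `<=` U]].

Lemma outer_content_le A U : open U -> A `<=` U ->
  outer_content A <= inner_content U.
Proof.
move=> oU AU; apply: ge_inf; last by exists U.
by exists 0 => _ [V _ <-]; exact: inner_content_ge0.
Qed.

Lemma outer_content_ge A c :
  (forall U, open U -> A `<=` U -> c <= inner_content U) -> c <= outer_content A.
Proof.
move=> h; apply: lb_le_inf; last by move=> _ [U [oU AU] <-]; exact: h.
by exists (inner_content setT), setT => //; split => //; exact: openT.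
Qed.

Lemma outer_content_open U : open U -> outer_content U = inner_content U.
Proof.
move=> oU; apply/eqP; rewrite eq_le outer_content_le//=.
by apply: outer_content_ge => V _; exact: inner_content_mono.
Qed.

Lemma outer_content_adherent A e : 0 < e ->
  exists U, [/\ open U, A `<=` U & inner_content U <= outer_content A + e].
Proof.
move=> e0; have [|_ [U [oU AU] <-] /ltW Ue] := @inf_adherent _
    [set inner_content U | U in [set U | open U /\ A `<=` U]] _ e0.
  split; first by exists (inner_content setT), setT => //; split => //; exact: openT.
  by exists 0 => _ [V _ <-]; exact: inner_content_ge0.
by exists U.
Qed.

(** * Outer measure and Caratheodory measurability of Borel sets *)

Definition content_outer_measure (A : set X) : \bar R := (outer_content A)%:E.
Local Notation mu := content_outer_measure.

Let mu0 : mu set0 = 0%E.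
Proof.
rewrite /mu outer_content_open; last exact: open0.
congr EFin; apply/eqP; rewrite eq_le inner_content_ge0 andbT.
by apply: inner_content_le => C _; rewrite subset0 => ->; rewrite fin_additive0.
Qed.

Let mu_ge0 A : (0 <= mu A)%E.
Proof.
by rewrite lee_fin; apply: outer_content_ge => U _ _; exact: inner_content_ge0.
Qed.

Let le_mu : {homo mu : A B / A `<=` B >-> (A <= B)%E}.
Proof.
move=> A B AB; rewrite lee_fin; apply: outer_content_ge => U oU BU.
by apply: outer_content_le => //; exact: subset_trans BU.
Qed.

(** Open neighbourhoods of the [F i], with errors summing to at most [e], reduce the claim to open
    sets. *)
Let mu_sigma_subadditive : sigma_subadditive mu.
Proof.
move=> F; apply/lee_addgt0Pr => e e0.
apply: (le_trans _ (epsilon_trick _ _ (ltW e0))) => //.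
have /choice[U UP] : forall i, exists U, [/\ open U, F i `<=` U &
    inner_content U <= outer_content (F i) + e / (2 ^ i.+1)%:R].
  move=> i; apply: outer_content_adherent.
  by rewrite divr_gt0// ltr0n expn_gt0.
apply: (@le_trans _ _ (\sum_(i <oo) (inner_content (U i))%:E)%E); last first.
  apply: lee_nneseries => [i _ _|i _]; first by rewrite lee_fin inner_content_ge0.
  by rewrite -EFinD lee_fin; have [] := UP i.
apply: (le_trans _ (inner_content_bigcup _)); last by move=> i; have [] := UP i.
rewrite lee_fin; apply: outer_content_le.
  by apply: bigcup_open => i _; have [] := UP i.
by apply: subset_bigcup => i _; have [] := UP i.
Qed.

HB.instance Definition _ := isOuterMeasure.Build R X mu
  mu0 mu_ge0 le_mu mu_sigma_subadditive.

(** It suffices to test open [U] containing [A]. Exhaust the intersection of [U] and [V] by closed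
    sets [C]; then [U] minus [C] is open, contains [A] minus [V], and is exhausted by closed sets
    [D]. As [C] and [D] are disjoint closed subsets of [U], their [lam]-masses add up inside [U]. *)
Lemma open_caratheodory V : open V -> caratheodory_measurable mu V.
Proof.
move=> oV; apply: le_caratheodory_measurable => A.
rewrite /mu -EFinD lee_fin; apply: outer_content_ge => U oU AU.
apply: (@le_trans _ _ (inner_content (U `&` V) + outer_content (A `&` ~` V))).
  rewrite lerD2r; apply: outer_content_le; first exact: openI.
  exact: setSI.
rewrite -lerBrDr; apply: inner_content_le => C cC CUV.
rewrite lerBrDr addrC -lerBrDr.
apply: (@le_trans _ _ (inner_content (U `&` ~` C))).
  apply: outer_content_le; first by apply: openI => //; exact: closed_openC.
  by apply: setISS => //; apply: subsetC => x /CUV[].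
apply: inner_content_le => D cD DUC.
rewrite lerBrDr -lamP.2; last by apply/disjoints_subset => x /DUC[].
apply: inner_content_ge; first exact: closedU.
by rewrite subUset; split => x; [move=> /DUC[]|move=> /CUV[]].
Qed.

Lemma borel_caratheodory : @measurable _ (@borel_of R X) `<=` caratheodory_measurable mu.
Proof.
apply: smallest_sub; last exact: open_caratheodory.
exact: (@sigma_algebra_measurable _ (caratheodory_type mu)).
Qed.

(** A second name for the same function, on [borel_of], so that the measure structure is attached
    apart from the outer measure structure. *)
Definition content_measure : set (@borel_of R X) -> \bar R := mu.

Let content_measure_sigma_additive : semi_sigma_additive content_measure.
Proof.
move=> F mF tF mUF.
apply: (@caratheodory_measure_sigma_additive _ _ mu) => //.
- by move=> i; exact: borel_caratheodory.
- exact: borel_caratheodory.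
Qed.

HB.instance Definition _ := isMeasure.Build _ _ _ content_measure
  mu0 mu_ge0 content_measure_sigma_additive.

Hypothesis lamT : lam setT = 1.

Let content_measure_setT : content_measure setT = 1%E.
Proof.
rewrite /content_measure /mu outer_content_open; last exact: openT.
congr EFin; apply/eqP; rewrite eq_le -lamT.
apply/andP; split; last exact: inner_content_ge closedT _.
by apply: inner_content_le => C _ _; exact: le_fin_additive.
Qed.

HB.instance Definition _ := Measure_isProbability.Build _ _ _ content_measure
  content_measure_setT.

Theorem content_regularization : exists mu : probability (@borel_of R X) R,
  forall U : set X, open U -> (mu U <= (lam U)%:E)%E.
Proof.
exists content_measure => U oU.
rewrite /= /content_measure lee_fin outer_content_open//.
by apply: inner_content_le => C _; exact: le_fin_additive.
Qed.

End borel_regularization.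

(** * Bowen balls *)

(** Greedy selection: pick [y] in [A], charge [theta * v y] to the sets containing [y], whose
    weights sum to at least [theta], delete these sets and recurse on the points that share no set
    with [y]. *)
Lemma weighted_selection {R : realType} {T : eqType} {I : Type}
    (E : I -> set T) (a u : I -> R) (v : T -> R) (theta : R) :
  0 < theta -> (forall y, 0 <= v y) -> (forall i, 0 <= u i) ->
  (forall i y, E i y -> v y <= u i) ->
  forall (s : seq I) (A : set T), all (fun i => 0 <= a i) s ->
  (forall x, A x -> theta <= \sum_(i <- s | x \in E i) a i) ->
  exists ys : seq T,
    (forall x, A x -> exists y i, [/\ y \in ys, E i y & E i x]) /\
    theta * (\sum_(y <- ys) v y) <= \sum_(i <- s) a i * u i.
Proof.
move=> th0 v0 u0 vu s; have [n] := ubnP (size s).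
elim: n s => // n IHn s; rewrite ltnS => sn A a0 thA.
have sum0 (P : pred I) : 0 <= \sum_(i <- s | P i) a i * u i.
  elim: s a0 {sn thA} => [|i s IHs] /=; first by rewrite big_nil.
  case/andP => i0 s0; rewrite big_cons; case: ifP => _; last exact: IHs.
  by rewrite addr_ge0 ?IHs// mulr_ge0.
have [[y Ay]|A0] := pselect (A !=set0); last first.
  exists [::]; split; last by rewrite big_nil mulr0.
  by move=> x Ax; exfalso; apply: A0; exists x.
pose s' := [seq i <- s | y \notin E i].
(* As [theta > 0], at least one set of the list contains [y], so the list shrinks. *)
have s'n : (size s' < n)%N.
  apply: leq_trans sn; rewrite size_filter -(count_predC (fun i => y \notin E i) s).
  rewrite -addn1 leq_add2l -has_count; apply/negPn/negP => hs.
  have := thA y Ay; rewrite -big_filter.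
  have -> : [seq i <- s | y \in E i] = [::].
    apply/nilP; rewrite /nilp size_filter -leqn0 leqNgt -has_count.
    by apply: contra hs; apply: sub_has => i /=; rewrite negbK.
  by rewrite big_nil leNgt th0.
(* These points lie in none of the deleted sets and keep their whole sum. *)
pose A' := [set x | A x /\ forall i, E i y -> ~ E i x].
have [|x [Ax xy]|ys [ysA ysv]] := IHn s' s'n A'.
- by rewrite all_filter; apply: sub_all a0 => i /= ->; rewrite implybT.
- rewrite big_filter_cond; apply: (le_trans (thA x Ax)).
  rewrite le_eqVlt; apply/orP; left; apply/eqP; apply: eq_bigl => i /=.
  have [/set_mem xi|] := boolP (x \in E i); last by rewrite andbF.
  by rewrite andbT; apply/esym/negP => /set_mem yi; exact: xy xi.
exists (y :: ys); split.
  move=> x Ax; have [[i [yi xi]]|h] := pselect (exists i, E i y /\ E i x).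
    by exists y, i; rewrite mem_head.
  have [|z [i [zys zi xi]]] := ysA x.
    by split=> // i yi xi; apply: h; exists i.
  by exists z, i; rewrite in_cons zys orbT.
rewrite big_cons mulrDr (bigID (fun i => y \in E i))/= lerD//; last first.
  by rewrite big_filter in ysv.
apply: (@le_trans _ _ (\sum_(i <- s | y \in E i) a i * v y)).
  by rewrite -mulr_suml ler_wpM2r// thA.
elim: s a0 {sn thA sum0 s' s'n ysv} => [|i s IHs] /=; first by rewrite !big_nil.
case/andP => i0 s0; rewrite !big_cons; case: ifP => [/set_mem yi|_]; last exact: IHs.
by rewrite lerD ?IHs// ler_wpM2l// vu.
Qed.

Section bowen_balls.
Context {R : realType} {X : pointedMetricType R}.
Variables (f : X -> X) (phi : X -> R) (alpha : R).
Local Notation B n x eps := (bowen_ball f alpha n x eps).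

(** Positivity of [eps] matches the initial value 0 of the maximum; in particular the ball of order
    0 is the whole space. *)
Lemma bowen_ballP n x eps y : 0 < eps ->
  B n x eps y <-> forall i, (i < n)%N ->
    expR (alpha * i%:R) * mdist (iter i f x) (iter i f y) < eps.
Proof.
move=> e0; rewrite /bowen_ball /dn_alpha /=; split.
  by move=> /bigmax_ltP[_ h] i ni; exact: (h (Ordinal ni)).
by move=> h; apply/bigmax_ltP; split => // i _; exact: h.
Qed.

Lemma bowen_ball_center n x eps : 0 < eps -> B n x eps x.
Proof. by move=> e0; apply/bowen_ballP => // i _; rewrite mdistxx mulr0. Qed.

Lemma bowen_ball_sym n x eps y : 0 < eps -> B n x eps y -> B n y eps x.
Proof.
by move=> e0 /bowen_ballP - /(_ e0) h; apply/bowen_ballP => // i /h; rewrite metric_sym.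
Qed.

Lemma bowen_ball_triangle n x e1 y e2 z : 0 < e1 -> 0 < e2 ->
  B n x e1 y -> B n y e2 z -> B n x (e1 + e2) z.
Proof.
move=> e10 e20 /bowen_ballP - /(_ e10) h1 /bowen_ballP - /(_ e20) h2.
apply/bowen_ballP => [|i ni]; first exact: addr_gt0.
apply: le_lt_trans (ltrD (h1 i ni) (h2 i ni)).
by rewrite -mulrDr ler_wpM2l ?expR_ge0// metric_triangle.
Qed.

Lemma le_bowen_ball n x e1 e2 : e1 <= e2 -> B n x e1 `<=` B n x e2.
Proof. by move=> e12 y; rewrite /bowen_ball /= => /lt_le_trans; exact. Qed.

Hypothesis cf : continuous f.

Lemma continuous_iter n : continuous (iter n f).
Proof.
elim: n => [|n IHn] x; first exact: cvg_id.
by apply: (@continuous_comp _ _ _ (iter n f) f); [exact: IHn|exact: cf].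
Qed.

Lemma open_bowen_ball n x eps : 0 < eps -> open (B n x eps).
Proof.
move=> e0; rewrite openE => y By; rewrite /interior.
have near_iter i : expR (alpha * i%:R) * mdist (iter i f x) (iter i f y) < eps ->
    \forall z \near y, expR (alpha * i%:R) * mdist (iter i f x) (iter i f z) < eps.
  set c := expR _ => yi; have c0 : 0 < c by exact: expR_gt0.
  have := metricType_numDomainType.cvgr_dist_lt (@continuous_iter i y).
  move=> /(_ _ (eps / c - mdist (iter i f x) (iter i f y))).
  rewrite subr_gt0 ltr_pdivlMr// mulrC => /(_ yi); apply: filterS => z yz.
  rewrite mulrC -ltr_pdivlMr//.
  by apply: le_lt_trans (metric_triangle _ (iter i f y) _) _; rewrite -ltrBrDl.
have : forall k, (k <= n)%N -> \forall z \near y, forall i, (i < k)%N ->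
    expR (alpha * i%:R) * mdist (iter i f x) (iter i f z) < eps.
  elim=> [|k IHk] kn; first exact: nearW.
  have yk := near_iter k ((bowen_ballP _ _ _ e0).1 By k kn).
  apply: filterS2 (IHk (ltnW kn)) yk => z zi zk i.
  by rewrite ltnS leq_eqVlt => /predU1P[->//|]; exact: zi.
move=> /(_ n (leqnn n)); apply: filterS => z zi.
exact/bowen_ballP.
Qed.

(** * Birkhoff sums on Bowen balls *)

Variables (m M : R).
Hypotheses (m_le : forall x, m <= phi x) (phi_le : forall x, phi x <= M).
Local Notation S := (birkhoff f phi).

Lemma birkhoff_ge n x : m * n%:R <= S n x.
Proof.
rewrite /birkhoff -[n in n%:R]subn0 mulr_natr -sumr_const_nat.
exact: ler_sum.
Qed.

Lemma birkhoff_le n x : S n x <= M * n%:R.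
Proof.
rewrite /birkhoff -[n in n%:R]subn0 mulr_natr -sumr_const_nat.
exact: ler_sum.
Qed.

(** The supremum inside [ball_weight], to which it unfolds; [phi <= M] keeps it finite. *)
Definition ball_sup n x eps : R := sup [set S n y | y in B n x eps].

Lemma ball_sup_ge n x eps y : B n x eps y -> S n y <= ball_sup n x eps.
Proof.
move=> By; apply: ub_le_sup; last by exists y.
by exists (M * n%:R) => _ [z _ <-]; exact: birkhoff_le.
Qed.

Lemma ball_sup_le n x eps c : 0 < eps -> (forall y, B n x eps y -> S n y <= c) ->
  ball_sup n x eps <= c.
Proof.
move=> e0 h; apply: ge_sup; last by move=> _ [y By <-]; exact: h.
by exists (S n x), x => //; exact: bowen_ball_center.
Qed.

Lemma ball_sup_mono n x y e1 e2 : 0 < e1 -> B n x e1 `<=` B n y e2 ->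
  ball_sup n x e1 <= ball_sup n y e2.
Proof. by move=> e10 xy; apply: ball_sup_le => // z /xy; exact: ball_sup_ge. Qed.

Lemma ball_sup_ge_min n x eps : 0 < eps -> m * n%:R <= ball_sup n x eps.
Proof.
move=> e0; apply: le_trans (birkhoff_ge n x) (ball_sup_ge _).
exact: bowen_ball_center.
Qed.

Lemma M_N_le_seq (K : set X) s eps N (l : seq (nat * X)) :
  (forall p, p \in l -> (N <= p.1)%N) ->
  (forall x, K x -> exists2 p, p \in l & B p.1 p.2 eps x) ->
  (M_N f phi alpha K s eps N <=
   (\sum_(p <- l) expR (- s * ball_sup p.1 p.2 eps))%:E)%E.
Proof.
move=> lN Kl; pose d : nat * X := (0%N, point).
apply: ereal_inf_lbound; exists (`I_(size l), fun i => (nth d l i).2, fun i => (nth d l i).1).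
  split => /= [i il|x /Kl[p pl xp]]; first by apply: lN; exact: mem_nth.
  by exists (index p l); rewrite /= ?index_mem// nth_index.
rewrite /= esum_fset => [|//|i _]; last by rewrite lee_fin expR_ge0.
rewrite -fsbig_ord (big_nth d) big_mkord -sumEFin.
by apply: eq_bigr.
Qed.

(** * From weighted covers to honest covers *)

Lemma big_split_key (I : eqType) (l : seq I) (key : I -> nat) (L : nat) (F : I -> R) :
  (forall i, i \in l -> (key i < L)%N) ->
  \sum_(i <- l) F i = \sum_(k < L) \sum_(i <- l | key i == k) F i.
Proof.
move=> lL; rewrite (exchange_big_dep predT)//= big_seq [RHS]big_seq.
apply: eq_bigr => i /lL iL.
by rewrite (big_pred1 (Ordinal iL)).
Qed.

Local Notation theta delta n := (expR (- delta * (m * n%:R))).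

(* Some [n = N + k] carries a share [theta delta n] of the total load [>= 1] at
   each point; replacing [s] by [s + delta] pays for the division by that share. *)
Lemma M_N_le_cost (K : set X) s delta eps N (l : seq (R * (nat * X))) :
  0 <= s -> 0 <= delta -> 0 < eps ->
  (forall L, \sum_(k < L) theta delta (N + k) < 1) ->
  dominates (fun p : nat * X => B (N + p.1)%N p.2 eps) K l (cst 1) ->
  (M_N f phi alpha K (s + delta) (eps + eps) N <=
   (cost (fun p : nat * X => expR (- s * ball_sup (N + p.1)%N p.2 eps)) l)%:E)%E.
Proof.
move=> s0 d0 e0 sum1 [l0 l1].
have ee0 : 0 < eps + eps by exact: addr_gt0.
(* Level [k] holds the members of order [N + k]. With the raised exponent, [u] weighs the given
   balls and [v] the doubled ones; [A k] is where level [k] carries its share. *)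
pose E k (i : R * X) := B (N + k)%N i.2 eps.
pose t k : seq (R * X) := [seq (i.1, i.2.2) | i <- l & i.2.1 == k].
pose u k (i : R * X) := expR (- (s + delta) * ball_sup (N + k)%N i.2 eps).
pose v k y := expR (- (s + delta) * ball_sup (N + k)%N y (eps + eps)).
pose A k := [set x | theta delta (N + k) <= \sum_(i <- t k | x \in E k i) i.1].
have /choice[ys ysP] : forall k, exists ys : seq X,
    (forall x, A k x -> exists y i, [/\ y \in ys, E k i y & E k i x]) /\
    theta delta (N + k) * (\sum_(y <- ys) v k y) <= \sum_(i <- t k) i.1 * u k i.
  move=> k; apply: weighted_selection; rewrite ?expR_gt0//.
  - by move=> y; exact: expR_ge0.
  - by move=> i; exact: expR_ge0.
  (* The doubled ball around a point [y] of the ball contains that ball, so its supremum is larger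
     and its weight smaller. *)
  - move=> i y iy; rewrite /v /u ler_expR !mulNr lerN2.
    apply: ler_wpM2l; first exact: addr_ge0.
    apply: ball_sup_mono => // z iz.
    exact: bowen_ball_triangle (bowen_ball_sym e0 iy) iz.
  - rewrite /t all_map all_filter; apply: sub_all l0 => i /= ->.
    by rewrite implybT.
pose L := (\max_(i <- l) i.2.1).+1.
have lL i : i \in l -> (i.2.1 < L)%N.
  by move=> il; rewrite ltnS; exact: (@leq_bigmax_seq _ l xpredT (fun i => i.2.1) i).
pose ls := flatten [seq [seq ((N + k)%N, y) | y <- ys k] | k <- iota 0 L].
have lsP k y : (k < L)%N -> y \in ys k -> ((N + k)%N, y) \in ls.
  move=> kL yk; apply/flattenP; exists [seq ((N + k)%N, y) | y <- ys k].
    by apply/mapP; exists k; rewrite // mem_iota.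
  by apply/mapP; exists y.
apply: le_trans (@M_N_le_seq _ _ _ _ ls _ _) _.
- move=> p /flattenP[_ /mapP[k _ ->] /mapP[y _ ->]] /=.
  exact: leq_addr.
- move=> x Kx; suff [k kL Akx] : exists2 k, (k < L)%N & A k x.
    have [y [i [yk yi xi]]] := (ysP k).1 x Akx.
    exists ((N + k)%N, y); first exact: lsP.
    exact: bowen_ball_triangle (bowen_ball_sym e0 yi) xi.
  (* If no level carried its share at [x], the load there would be at most the sum of the shares,
     hence below 1. *)
  apply: contrapT => noA; have := l1 x Kx.
  rewrite /load (big_split_key _ lL) /= leNgt => /negP; apply.
  apply: le_lt_trans (sum1 L); apply: ler_sum => k _.
  have /negP : ~ A k x by move=> Akx; apply: noA; exists k.
  rewrite -ltNge => /ltW; apply: le_trans.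
  rewrite big_map big_filter_cond big_mkcondr /=.
  apply: ler_sum => i /eqP ik; rewrite indicE /E ik.
  by case: (x \in _); rewrite ?mulr1 ?mulr0.
rewrite lee_fin big_flatten big_map -[iota 0 L]/(index_iota 0 L) big_mkord.
rewrite /cost (big_split_key _ lL); apply: ler_sum => k _.
rewrite big_map -(ler_pM2l (expR_gt0 (- delta * (m * (N + k)%:R)))).
apply: (le_trans (ysP k).2); rewrite big_map big_filter mulr_sumr.
rewrite big_seq_cond [leRHS]big_seq_cond; apply: ler_sum => i /andP[il /eqP ik].
rewrite mulrCA; apply: ler_wpM2l; first exact: (allP l0).
rewrite /u ik -expRD ler_expR !mulNr -opprD lerN2 mulrDl [leLHS]addrC lerD2l.
by apply: ler_wpM2l => //; exact: ball_sup_ge_min.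
Qed.

(** * Frostman measures for Bowen balls *)

Lemma exists_dominating_balls (K : set X) eps N : compact K -> 0 < eps ->
  exists l : seq (R * (nat * X)),
    dominates (fun p : nat * X => B (N + p.1)%N p.2 eps) K l (cst 1).
Proof.
move=> cK e0; move: cK; rewrite compact_cover.
move=> /(_ _ setT (fun x => B N x eps)) [].
- by move=> x _; exact: open_bowen_ball.
- by move=> x Kx; exists x => //; exact: bowen_ball_center.
move=> D _ KD; exists [seq (1, (0%N, x)) | x <- finmap.enum_fset D]; split.
  by rewrite /nonneg_family all_map; apply/allP => x _ /=; exact: ler01.
move=> y /KD[x xD xy]; rewrite /load big_map /= (big_rem x)//= mul1r addn0.
rewrite indicE mem_set// lerDl.
by apply: sumr_ge0 => z _; rewrite mul1r indicE ler0n.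
Qed.

(** [weighted_frostman] is applied with [c] equal to [M_N], the index [(k, x)] standing for the ball
    of order [N + k]. Regularization keeps the bounds on Bowen balls and the nullity of the
    complement of [K], all of these sets being open. *)
Theorem bowen_frostman (K : set X) s delta eps N :
  compact [set: X] -> compact K -> 0 <= s -> 0 <= delta -> 0 < eps ->
  (forall L, \sum_(k < L) theta delta (N + k) < 1) ->
  (0 < M_N f phi alpha K (s + delta) (eps + eps) N)%E ->
  exists (mu : probability (@borel_of R X) R) (c : R), [/\ 0 < c, mu K = 1%E &
    forall n x, (N <= n)%N ->
      (mu (B n x eps) <= (expR (- s * ball_sup n x eps) / c)%:E)%E].
Proof.
move=> cX cK s0 d0 e0 sum1; have Kdom := exists_dominating_balls N cK e0.
have cle := fun l => @M_N_le_cost K s delta eps N l s0 d0 e0 sum1.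
case: (M_N _ _ _ _ _ _ _) cle => [c||] cle; last by rewrite lt0e.
- rewrite lte_fin => c0.
  have [||lam [lamP lamT lamK lamB]] := @weighted_frostman R X
    (nat * X)%type _ (fun p => expR (- s * ball_sup (N + p.1)%N p.2 eps)) K c _ c0 Kdom.
  + by move=> p; exact: expR_ge0.
  + by move=> l /cle; rewrite lee_fin; exact.
  have [mu muU] := content_regularization lamP cX lamT.
  have clK : closed K by apply: compact_closed cK; exact: metric_hausdorff.
  have oK : open (~` K) by exact: closed_openC.
  have moK : measurable (~` K : set borel_of) by exact: sub_sigma_algebra.
  have muK : mu (~` K) = 0%E.
    apply/eqP; rewrite eq_le measure_ge0 andbT.
    by apply: le_trans (muU _ oK) _; rewrite lamK.
  exists mu, c; split => //.
    by rewrite -[K]setCK probability_setC// muK sube0.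
  move=> n x Nn; apply: le_trans (muU _ (open_bowen_ball _ _ e0)) _.
  by rewrite lee_fin; have := lamB ((n - N)%N, x); rewrite /= subnKC.
(* The value [+oo] is excluded, since a finite dominating family has finite cost. *)
- by have [l /cle] := Kdom; rewrite leye_eq.
Qed.

End bowen_balls.

(** * Limits and integrals *)

Section integral_const.
Local Open Scope ereal_scope.
Context d {T : measurableType d} {R : realType} (mu : probability T R).

Import HBNNSimple.

(** For an arbitrary nonnegative [g] the integral is the supremum over simple functions below [g],
    and each of these is at most [s] almost everywhere. *)
Lemma ge0_integral_le_cst (g : T -> \bar R) (s : R) : (0 <= s)%R ->
  (forall x, 0 <= g x) -> mu.-negligible [set x | s%:E < g x] ->
  \int[mu]_x g x <= s%:E.
Proof.
move=> s0 g0 [N [mN muN gN]]; rewrite ge0_integralTE//.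
apply: ge_ereal_sup => _ [h hg <-]; rewrite -integralT_nnsfun.
have -> : s%:E = \int[mu]_x (cst s%:E x) :> \bar R.
  by rewrite integral_cst// [X in _ * X](probability_setT mu) mule1.
apply: ae_ge0_le_integral => //.
- by move=> x _; rewrite lee_fin.
- exact/measurable_realfun.measurable_EFinP/measurable_funP.
- exists N; split => // x /= hx; apply: gN; rewrite /= ltNge.
  by apply/negP => gs; apply: hx => _; exact: le_trans (hg x) gs.
Qed.

Lemma ge0_integral_ge_cst (g : T -> \bar R) (s : R) : (0 <= s)%R ->
  (forall x, s%:E <= g x) -> s%:E <= \int[mu]_x g x.
Proof.
move=> s0 sg; rewrite ge0_integralTE; last first.
  by move=> x; apply: le_trans (sg x); rewrite lee_fin.
apply: ereal_sup_ubound; exists (cst_nnsfun T (NngNum s0)) => //.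
rewrite -integralT_nnsfun /= integral_cst//.
by rewrite [X in _ * X](probability_setT mu) mule1.
Qed.

(** Intersecting covers of mass at most [1 / (n + 1)] gives a measurable null set containing [A]. *)
Lemma negligible_small (A : set T) :
  (forall e : R, (0 < e)%R ->
     exists U, [/\ measurable U, A `<=` U & mu U <= e%:E]) ->
  mu.-negligible A.
Proof.
move=> h; have /choice[U UP] : forall n : nat, exists U,
    [/\ measurable U, A `<=` U & mu U <= (n.+1%:R^-1 : R)%:E].
  by move=> n; apply: h; rewrite invr_gt0.
exists (\bigcap_n U n); split.
- by apply: bigcap_measurable => // n _; have [] := UP n.
- apply/eqP; rewrite eq_le measure_ge0 andbT; apply/lee_addgt0Pr => e e0.
  rewrite add0e; have [n ne] : exists n : nat, (n.+1%:R^-1 <= e)%R.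
    exists (Num.truncn e^-1); rewrite invf_ple ?posrE//.
    by rewrite ltW// truncnS_gt.
  have [mU _ Un] := UP n; apply: (@le_trans _ _ (mu (U n))).
    apply: le_measure; rewrite ?inE//; last exact: bigcap_inf.
    by apply: bigcap_measurable => // k _; have [] := UP k.
  by apply: le_trans Un _; rewrite lee_fin.
- by move=> x Ax n _; have [_ +  _] := UP n; exact.
Qed.

End integral_const.

Lemma le_Nlne {R : realType} (x : \bar R) (c : R) : (0 <= x)%E ->
  (c%:E <= - lne x)%E = (x <= (expR (- c))%:E)%E.
Proof.
move=> x0; rewrite leeNr -EFinN.
have -> : (- c)%:E = lne (expR (- c))%:E by rewrite lne_EFin ?expR_gt0// expRK.
by rewrite lee_lne// in_itv /= leey andbT// lee_fin expR_ge0.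
Qed.

Lemma limn_einf_sup_einfs {R : realType} (u : (\bar R)^nat) :
  limn_einf u = ereal_sup (range (einfs u)).
Proof. by rewrite limn_einf_lim; apply/cvg_lim => //; exact: cvg_einfs_sup. Qed.

Lemma limn_einf_gt {R : realType} (u : (\bar R)^nat) c : (c < limn_einf u)%E ->
  exists N, forall n, (N <= n)%N -> (c < u n)%E.
Proof.
rewrite limn_einf_sup_einfs => /ereal_sup_gt[_ [N _ <-] cN].
by exists N => n Nn; apply: lt_le_trans cN _; apply: ereal_inf_lbound; exists n.
Qed.

Lemma limn_einf_ge {R : realType} (u : (\bar R)^nat) c N :
  (forall n, (N <= n)%N -> (c <= u n)%E) -> (c <= limn_einf u)%E.
Proof.
move=> h; rewrite limn_einf_sup_einfs; apply: (@le_trans _ _ (einfs u N)).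
  by apply: le_ereal_inf_tmp => _ [n Nn <-]; exact: h.
by apply: ereal_sup_ubound; exists N.
Qed.

Lemma le_limn_einf {R : realType} (u v : (\bar R)^nat) :
  (forall n, (u n <= v n)%E) -> (limn_einf u <= limn_einf v)%E.
Proof.
move=> uv; rewrite !limn_einf_sup_einfs; apply: ge_ereal_sup => _ [N _ <-].
apply: (@le_trans _ _ (einfs v N)); last by apply: ereal_sup_ubound; exists N.
apply: le_ereal_inf_tmp => _ [n Nn <-]; apply: le_trans (uv n).
by apply: ereal_inf_lbound; exists n.
Qed.

(** Turns the limits in [eps] defining [dim_BS] and [local_BK] into suprema. *)
Lemma lim_at0_right_nonincreasing {R : realType} (g : R -> \bar R) :
  (forall a b, 0 < a -> a <= b -> (g b <= g a)%E) ->
  lim (g e @[e --> 0^'+]) = ereal_sup [set g e | e in [set e | 0 < e]].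
Proof.
move=> gni; have -> : [set e : R | 0 < e] = [set` `]0, +oo[].
  by apply/seteqP; split => e /=; rewrite in_itv /= andbT.
apply/cvg_lim => //; apply: (@nonincreasing_at_right_cvge _ _ _ +oo%O) => //.
by move=> a b; rewrite !in_itv /= !andbT => a0 _; exact: gni.
Qed.

(** If [phi] varies by less than [eta / 2] from [x] within radius [r], then radius [r / 2] works for
    all points within [r / 2] of [x]; compactness makes the radius uniform. *)
Lemma compact_unif_continuous {R : realType} {X : metricType R} (phi : X -> R) :
  compact [set: X] -> continuous phi -> forall eta, 0 < eta ->
  exists2 delta, 0 < delta &
    forall x y, mdist x y < delta -> `|phi x - phi y| <= eta.
Proof.
move=> cX cphi eta eta0.
pose P (e : R) (x : X) := forall y, mdist x y < e -> `|phi x - phi y| <= eta.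
have : \forall e \near 0^'+, [set: X] `<=` P e.
  apply: (compact_near_coveringP _).1 cX _ _ _ _ _ => x _.
  have /cvgrPdist_lt /(_ (eta / 2)) : phi y @[y --> x] --> phi x by exact: cphi.
  rewrite divr_gt0// => /(_ isT) /metricType_numDomainType.nbhs_mdistP[r /= r0 rphi].
  have r20 : 0 < r / 2 by rewrite divr_gt0.
  exists ([set y | mdist x y < r / 2], [set e | e < r / 2]).
    split => /=; last by apply: nbhs_right_lt.
    by apply/metricType_numDomainType.nbhs_mdistP; exists (r / 2).
  move=> [y e] /= [xy er] z yz.
  have h1 : `|phi x - phi y| < eta / 2 by apply: rphi => /=; lra.
  have h2 : `|phi x - phi z| < eta / 2.
    by apply: rphi => /=; have := metric_triangle x y z; lra.
  have := ler_distD (phi x) (phi y) (phi z).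
  by rewrite (distrC (phi y) (phi x)); lra.
move=> h; near (0 : R)^'+ => e.
have eP : [set: X] `<=` P e by near: e.
by exists e => // x y; exact: (eP x I).
Unshelve. all: by end_near. Qed.

(** * Dimension and local entropy *)

Section bowen_dimension.
Context {R : realType} {X : pointedMetricType R}.
Variables (f : X -> X) (phi : X -> R) (alpha : R).
Local Notation B n x eps := (bowen_ball f alpha n x eps).
Local Notation S := (birkhoff f phi).
Hypothesis cf : continuous f.
Variables (m M : R).
Hypotheses (m_gt0 : 0 < m) (m_le : forall x, m <= phi x) (phi_le : forall x, phi x <= M).

Lemma M_N_ge0 K s eps N : (0 <= M_N f phi alpha K s eps N)%E.
Proof.
apply: le_ereal_inf_tmp => _ [c _ <-]; apply: esum_ge0 => i _.
by rewrite lee_fin expR_ge0.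
Qed.

Lemma le_M_N K s eps N N' : (N <= N')%N ->
  (M_N f phi alpha K s eps N <= M_N f phi alpha K s eps N')%E.
Proof.
move=> NN'; apply: ereal_inf_le_tmp => _ [c [cN' Kc] <-]; exists c => //; split => // i Ii.
exact: leq_trans NN' (cN' i Ii).
Qed.

Lemma M_N_antimono K s e1 e2 N : 0 <= s -> 0 < e1 -> e1 <= e2 ->
  (M_N f phi alpha K s e2 N <= M_N f phi alpha K s e1 N)%E.
Proof.
move=> s0 e10 e12; apply: le_ereal_inf_tmp => _ [c [cN Kc] <-].
apply: (@le_trans _ _ (\esum_(i in c.1.1) ball_weight f phi alpha s e2 (c.2 i) (c.1.2 i))%E).
  apply: ereal_inf_lbound; exists c => //; split => // x /Kc[i ci xi].
  by exists i => //; exact: le_bowen_ball xi.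
apply: le_esum => i _; rewrite lee_fin ler_expR !mulNr lerN2 ler_wpM2l//.
by apply: (ball_sup_mono phi_le) => //; exact: le_bowen_ball.
Qed.

Lemma M_sE K s eps : M_s f phi alpha K s eps =
  ereal_sup (range (fun N => M_N f phi alpha K s eps N)).
Proof.
by apply/cvg_lim => //; apply: ereal_nondecreasing_cvgn => a b; exact: le_M_N.
Qed.

Lemma M_s_eq0 K s eps : M_s f phi alpha K s eps = 0%E <->
  forall N, M_N f phi alpha K s eps N = 0%E.
Proof.
rewrite M_sE; split => [h N|h].
  apply/eqP; rewrite eq_le M_N_ge0 andbT -h.
  by apply: ereal_sup_ubound; exists N.
apply/eqP; rewrite eq_le; apply/andP; split.
  by apply: ge_ereal_sup => _ [N _ <-]; rewrite h.
by apply: ereal_sup_ubound; exists 0%N.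
Qed.

Lemma M_crit_ge0 K eps : (0 <= M_crit f phi alpha K eps)%E.
Proof. by apply: le_ereal_inf_tmp => _ [s [s0 _] <-]; rewrite lee_fin. Qed.

Lemma M_crit_antimono K e1 e2 : 0 < e1 -> e1 <= e2 ->
  (M_crit f phi alpha K e2 <= M_crit f phi alpha K e1)%E.
Proof.
move=> e10 e12; apply: ereal_inf_le_tmp => _ [s [s0 /M_s_eq0 Ms] <-].
exists s => //; split => //; apply/M_s_eq0 => N.
by apply/eqP; rewrite eq_le M_N_ge0 andbT -(Ms N) M_N_antimono.
Qed.

Lemma dim_BSE K : dim_BS f alpha K phi =
  ereal_sup [set M_crit f phi alpha K eps | eps in [set eps | 0 < eps]].
Proof. by apply: lim_at0_right_nonincreasing => a b; exact: M_crit_antimono. Qed.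

Lemma birkhoff_gt0 n x : (0 < n)%N -> 0 < S n x.
Proof.
move=> n0; apply: lt_le_trans (birkhoff_ge f m_le n x).
by rewrite mulr_gt0// ltr0n.
Qed.

Lemma birkhoff_ge0 n x : 0 <= S n x.
Proof. by apply: le_trans (birkhoff_ge f m_le n x); rewrite mulr_ge0// ltW. Qed.

(** * Local entropy is bounded by the dimension *)

Section measure.
Variable mu : probability (@borel_of R X) R.

Lemma measurable_bowen_ball n x eps : 0 < eps -> measurable (B n x eps : set borel_of).
Proof. by move=> e0; apply: sub_sigma_algebra; exact: open_bowen_ball. Qed.

Definition BK_quotient eps x n : \bar R :=
  ((- lne (mu (B n x eps))) * ((S n x)^-1)%:E)%E.

Lemma BK_quotient_ge0 eps x n : 0 < eps -> (0 <= BK_quotient eps x n)%E.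
Proof.
move=> e0; apply: mule_ge0; last by rewrite lee_fin invr_ge0 birkhoff_ge0.
rewrite oppe_ge0 lne_le0; apply: probability_le1.
exact: measurable_bowen_ball.
Qed.

Lemma BK_quotient_antimono e1 e2 x n : 0 < e1 -> e1 <= e2 ->
  (BK_quotient e2 x n <= BK_quotient e1 x n)%E.
Proof.
move=> e10 e12; apply: lee_wpmul2r; first by rewrite lee_fin invr_ge0 birkhoff_ge0.
rewrite leeN2 lee_lne ?in_itv /= ?leey ?andbT ?measure_ge0//.
have e20 : 0 < e2 by exact: lt_le_trans e12.
apply: le_measure; rewrite ?inE; [exact: measurable_bowen_ball..|].
exact: le_bowen_ball.
Qed.

Lemma local_BKE x : local_BK mu f alpha x phi =
  ereal_sup [set limn_einf (BK_quotient eps x) | eps in [set eps | 0 < eps]].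
Proof.
apply: lim_at0_right_nonincreasing => a b a0 ab.
by apply: le_limn_einf => n; exact: BK_quotient_antimono.
Qed.

Lemma local_BK_ge0 x : (0 <= local_BK mu f alpha x phi)%E.
Proof.
rewrite local_BKE.
apply: (@le_trans _ _ (limn_einf (BK_quotient 1 x))).
  by apply: (@limn_einf_ge _ _ _ 0%N) => n _; exact: BK_quotient_ge0.
by apply: ereal_sup_ubound; exists 1 => /=.
Qed.

(** Turns entropy bounds into mass bounds; [0 < n] makes the divisor [S n x] positive. *)
Lemma BK_quotient_geE s eps x n : (0 < n)%N -> 
  (s%:E <= BK_quotient eps x n)%E = (mu (B n x eps) <= (expR (- (s * S n x)))%:E)%E.
Proof.
move=> n0; rewrite /BK_quotient lee_pdivlMr; last exact: birkhoff_gt0.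
by rewrite -EFinM le_Nlne.
Qed.

Hypothesis alpha_ge0 : 0 <= alpha.

(** As [alpha >= 0], the factors [exp (alpha * i)] are at least 1, so the first [n] iterates of [x]
    and [y] stay [eps]-close and each term contributes at most [eta]. *)
Lemma birkhoff_close n x y eps eta : 0 < eps ->
  (forall u v, mdist u v < eps -> `|phi u - phi v| <= eta) ->
  B n x eps y -> `|S n x - S n y| <= eta * n%:R.
Proof.
move=> e0 unif /bowen_ballP - /(_ e0) xy.
rewrite /birkhoff -sumrB (le_trans (ler_norm_sum _ _ _))//.
rewrite -[n in n%:R]subn0 mulr_natr -sumr_const_nat.
rewrite big_nat_cond [leRHS]big_nat_cond; apply: ler_sum => i; rewrite andbT => ni.
apply: unif; apply: le_lt_trans (xy i ni).
by rewrite ler_peMl ?mdist_ge0// -[leLHS]expR0 ler_expR mulr_ge0.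
Qed.

(* At a point [y] of [B n x eps'] where the Bowen ball is [mu]-small, uniform
   continuity compares [S n y] with its supremum over [B n x eps']. *)
Lemma covered_ball_small s s1 eps eps' eta n x y : (0 < n)%N ->
  0 < eps' -> eps' + eps' <= eps -> 0 <= s1 -> s1 * (m + (eta + eta)) <= s * m ->
  0 <= eta ->
  (forall u v, mdist u v < eps' -> `|phi u - phi v| <= eta) ->
  B n x eps' y -> (mu (B n y eps) <= (expR (- (s * S n y)))%:E)%E ->
  (mu (B n x eps') <= ball_weight f phi alpha s1 eps' n x)%E.
Proof.
move=> n0 e'0 e'e s10 ss1 eta0 unif xy muy.
apply: (@le_trans _ _ (mu (B n y eps))).
  apply: le_measure; rewrite ?inE; try exact: measurable_bowen_ball.
    by apply: measurable_bowen_ball; apply: lt_le_trans e'e; exact: addr_gt0.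
  move=> z xz; apply: le_bowen_ball e'e _ _.
  exact: bowen_ball_triangle (bowen_ball_sym e'0 xy) xz.
apply: (le_trans muy); rewrite lee_fin ler_expR mulNr lerN2.
(* Going from [y] to another point of the ball through the centre [x] costs [eta * n] twice. *)
apply: (@le_trans _ _ (s1 * (S n y + (eta + eta) * n%:R))).
  apply: ler_wpM2l => //; apply: ball_sup_le => // z xz.
  have := birkhoff_close e'0 unif xz; have := birkhoff_close e'0 unif xy.
  rewrite !ler_norml => /andP[h1 h2] /andP[h3 h4].
  rewrite mulrDl; lra.
have := birkhoff_ge f m_le n y; set Sy := S n y => Sm.
(* After multiplication by [m], the bound [m * n <= S n y] turns the error into a multiple of
   [S n y]. *)
rewrite -(ler_pM2r m_gt0).
apply: (@le_trans _ _ (s1 * (m + (eta + eta)) * Sy)).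
  have -> : s1 * (Sy + (eta + eta) * n%:R) * m =
    s1 * (Sy * m + (eta + eta) * (m * n%:R)) by ring.
  have -> : s1 * (m + (eta + eta)) * Sy = s1 * (Sy * m + (eta + eta) * Sy) by ring.
  by rewrite ler_wpM2l// lerD2l ler_wpM2l// addr_ge0.
have -> : s * Sy * m = s * m * Sy by ring.
by rewrite ler_wpM2r// birkhoff_ge0.
Qed.

Lemma negligible_small_balls (K : set X) s s1 eps eps' eta N : (0 < N)%N ->
  0 < eps' -> eps' + eps' <= eps -> 0 <= s1 -> s1 * (m + (eta + eta)) <= s * m ->
  0 <= eta ->
  (forall u v, mdist u v < eps' -> `|phi u - phi v| <= eta) ->
  M_N f phi alpha K s1 eps' N = 0%E ->
  mu.-negligible (K `&` [set y | forall n, (N <= n)%N ->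
    (mu (B n y eps) <= (expR (- (s * S n y)))%:E)%E] : set borel_of).
Proof.
move=> N0 e'0 e'e s10 ss1 eta0 unif MN0; set A := (X in K `&` X).
apply: negligible_small => e e0.
have : (M_N f phi alpha K s1 eps' N < e%:E)%E by rewrite MN0 lte_fin.
move=> /ereal_inf_lt[_ [[[I xs] ns] [/= nsN KI] <-] Ie].
(* Only the balls of the cover that meet [A] have mass bounded by their weight; the others are
   replaced by the empty set. *)
pose J := [set i | I i /\ exists2 y, A y & B (ns i) (xs i) eps' y].
pose F i : set borel_of := if i \in J then B (ns i) (xs i) eps' else set0.
have mF i : measurable (F i).
  by rewrite /F; case: ifP => // _; exact: measurable_bowen_ball.
exists (\bigcup_i F i); split; first exact: bigcupT_measurable.
  move=> y [/KI[i Ii yi] Ay]; exists i => //.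
  by rewrite /F mem_set//; split=> //; exists y.
apply: (le_trans _ (ltW Ie)).
apply: (le_trans (measure_sigma_subadditive mu mF _ (@subset_refl _ _))).
  exact: bigcupT_measurable.
rewrite nneseries_esum; last by move=> i _; exact: measure_ge0.
rewrite [leRHS]esum_mkcond.
have -> : [set x : nat | xpredT x] = setT by apply/seteqP; split.
apply: le_esum => i _; rewrite /F; case: ifPn => [/set_mem[Ii [y Ay yi]]|_].
  rewrite mem_set//; apply: covered_ball_small ss1 eta0 unif yi (Ay _ _) => //.
    exact: leq_trans N0 (nsN i Ii).
  exact: nsN.
by rewrite measure0; case: ifP => // _; rewrite lee_fin expR_ge0.
Qed.

Hypothesis cX : compact [set: X].
Hypothesis cphi : continuous phi.

Lemma negligible_local_BK_gt (K : set X) (d s : R) :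
  closed K -> mu K = 1%E -> dim_BS f alpha K phi = d%:E -> 0 <= d -> d < s ->
  mu.-negligible ([set x | (s%:E < local_BK mu f alpha x phi)%E] : set borel_of).
Proof.
move=> clK muK dimd d0 ds.
have [s0 /andP[ds0 s0s]] : exists s0, d < s0 < s.
  by exists ((d + s) / 2); apply/andP; split; lra.
(* Chosen so that [s0 * (m + 2 * eta) = s * m]. *)
pose eta := (s - s0) * m / (2 * s0).
have s00 : 0 < s0 by lra.
have eta0 : 0 < eta by rewrite !(divr_gt0, mulr_gt0)// subr_gt0.
have [delta delta0 unif] := compact_unif_continuous cX cphi eta0.
(* Radii [1 / (k + 1)] suffice because the quotient grows as the radius shrinks; starting at [N.+1]
   keeps [n] positive. *)
pose A k N : set borel_of := [set y | forall n, (N.+1 <= n)%N ->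
    (mu (B n y k.+1%:R^-1) <= (expR (- (s * S n y)))%:E)%E].
have negA k N : mu.-negligible (K `&` A k N : set borel_of).
  (* Small enough for uniform continuity and for two balls of radius [eps'] to fit in radius
     [1 / (k + 1)]. *)
  pose eps' := Num.min delta (k.+1%:R^-1 / 2).
  have k0 : 0 < k.+1%:R^-1 :> R by rewrite invr_gt0.
  have e'0 : 0 < eps' by rewrite lt_min delta0 divr_gt0.
  have e'e : eps' + eps' <= k.+1%:R^-1.
    have e'k : eps' <= k.+1%:R^-1 / 2 by rewrite ge_min lexx orbT.
    by rewrite [leRHS]splitr lerD.
  have : (M_crit f phi alpha K eps' < s0%:E)%E.
    apply: (@le_lt_trans _ _ d%:E); last by rewrite lte_fin.
    by rewrite -dimd dim_BSE; apply: ereal_sup_ubound; exists eps'.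
  move=> /ereal_inf_lt[_ [s1 [s10 /M_s_eq0 Ms1] <-]]; rewrite lte_fin => s1s0.
  apply: negligible_small_balls e'0 e'e s10 _ (ltW eta0) _ (Ms1 N.+1) => //.
    apply: (@le_trans _ _ (s0 * (m + (eta + eta)))).
      by rewrite ler_wpM2r ?(ltW s1s0)// !addr_ge0// ltW.
    rewrite /eta mulrDr; have -> : s0 * ((s - s0) * m / (2 * s0) +
      (s - s0) * m / (2 * s0)) = (s - s0) * m by field; rewrite gt_eqF.
    by rewrite -mulrDl addrC subrK.
  move=> u v uv; apply: unif; apply: lt_le_trans uv _.
  by rewrite ge_min lexx.
have mK : measurable (~` K : set borel_of).
  by apply: sub_sigma_algebra; exact: closed_openC.
have muKC : mu (~` K) = 0%E.
  have mK' : measurable (K : set borel_of) by rewrite -[K]setCK; exact: measurableC.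
  by rewrite (probability_setC mu mK') muK subee.
have negU : mu.-negligible
    ((~` K : set borel_of) `|` \bigcup_k \bigcup_N (K `&` A k N)).
  apply: negligibleU; first by exists (~` K); split.
  by apply: negligible_bigcup => k; apply: negligible_bigcup => N; exact: negA.
apply: negligibleS negU => x /=; have [Kx|] := pselect (K x); last by left.
rewrite local_BKE => /ereal_sup_gt[_ [eps /= e0 <-] sx]; right.
have [k ke] : exists k : nat, (k.+1%:R^-1 : R) <= eps.
  exists (Num.truncn eps^-1); rewrite invf_ple ?posrE//.
  by rewrite ltW// truncnS_gt.
have [N NP] := limn_einf_gt sx.
exists k => //; exists N => //; split => // n Nn.
have n0 : (0 < n)%N by exact: leq_trans Nn.
rewrite -BK_quotient_geE//; apply: le_trans (ltW (NP n (ltnW Nn))) _.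
by apply: BK_quotient_antimono => //; rewrite invr_gt0.
Qed.

Lemma BK_entropy_le_dim (K : set X) : closed K -> mu K = 1%E ->
  (BK_entropy mu f alpha phi <= dim_BS f alpha K phi)%E.
Proof.
move=> clK muK; have dim0 : (0 <= dim_BS f alpha K phi)%E.
  rewrite dim_BSE; apply: le_trans (M_crit_ge0 K 1) _.
  by apply: ereal_sup_ubound; exists 1 => /=.
move: dim0; case dimd : (dim_BS f alpha K phi) => [d||] d0; [|exact: leey|by []].
rewrite lee_fin in d0; apply/lee_addgt0Pr => e e0; rewrite -EFinD.
apply: ge0_integral_le_cst; first by rewrite addr_ge0// ltW.
  exact: local_BK_ge0.
by apply: negligible_local_BK_gt dimd d0 _; rewrite // ltrDl.
Qed.

End measure.

(** * Measures of large entropy *)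

Hypothesis cX : compact [set: X].

(** The shares used in thinning form a geometric series of ratio [r < 1]; once [r ^+ N < 1 - r], its
    partial sums from [N] on are below [1 - r ^+ L < 1]. *)
Lemma small_geometric_tail (a : R) N0 : 0 < a -> exists2 N, (N0 <= N)%N &
  forall L, \sum_(k < L) expR (- a * (m * (N + k)%:R)) < 1.
Proof.
move=> a0; pose r := expR (- a * m).
have r0 : 0 < r by exact: expR_gt0.
have r1 : r < 1 by rewrite -expR0 ltr_expR mulNr oppr_lt0 mulr_gt0.
have [N N0N rN] : exists2 N, (N0 <= N)%N & r ^+ N < 1 - r.
  have : r ^+ n @[n --> \oo] --> (0 : R) by apply: cvg_expr; rewrite ger0_norm// ltW.
  move=> /cvgrPdist_lt /(_ (1 - r)); rewrite subr_gt0 => /(_ r1)[N1 _ hN1].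
  exists (maxn N0 N1); first exact: leq_maxl.
  have := hN1 (maxn N0 N1) (leq_maxr _ _).
  by rewrite sub0r normrN ger0_norm// exprn_ge0// ltW.
exists N => // L.
have -> : \sum_(k < L) expR (- a * (m * (N + k)%:R)) = r ^+ N * \sum_(k < L) r ^+ k.
  rewrite mulr_sumr; apply: eq_bigr => k _.
  by rewrite -exprD /r -expRM_natr mulrA.
have sumE : (1 - r) * (\sum_(k < L) r ^+ k) = 1 - r ^+ L.
  by rewrite -opprB mulNr -subrX1 opprB.
apply: (@le_lt_trans _ _ ((1 - r) * (\sum_(k < L) r ^+ k))).
  by rewrite ler_wpM2r ?(ltW rN)// sumr_ge0// => k _; rewrite exprn_ge0// ltW.
by rewrite sumE gtrBl exprn_gt0.
Qed.

Lemma exists_entropy_ge (K : set X) (t : R) : compact K -> 0 <= t ->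
  (t%:E < dim_BS f alpha K phi)%E ->
  exists mu : probability (@borel_of R X) R,
    mu K = 1%E /\ (t%:E <= BK_entropy mu f alpha phi)%E.
Proof.
move=> cK t0; rewrite dim_BSE => /ereal_sup_gt[_ [e /= e0 <-] te].
(* Two margins [delta]: one is spent by [bowen_frostman], the other absorbs the constant [c]. *)
have [delta d0 tde] : exists2 delta, 0 < delta &
    ((t + (delta + delta))%:E < M_crit f phi alpha K e)%E.
  case: (M_crit _ _ _ _ _) te => [c|_|//]; last by exists 1; rewrite ?ltry.
  rewrite lte_fin => tc; exists ((c - t) / 4); first by rewrite divr_gt0// subr_gt0.
  rewrite lte_fin; lra.
have [N0 MN0] : exists N, (0 < M_N f phi alpha K (t + (delta + delta)) e N)%E.
  apply: contrapT => noN; suff : (M_crit f phi alpha K e <= (t + (delta + delta))%:E)%E.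
    by rewrite leNgt tde.
  apply: ereal_inf_lbound; exists (t + (delta + delta)) => //; split.
    by rewrite !addr_ge0// ltW.
  apply/M_s_eq0 => N; apply/eqP; rewrite eq_le M_N_ge0 andbT leNgt.
  by apply/negP => MN; apply: noN; exists N.
have [N NN0 Nsum] := small_geometric_tail N0 d0.
have MN : (0 < M_N f phi alpha K (t + (delta + delta)) e N)%E.
  exact: lt_le_trans MN0 (le_M_N _ _ _ NN0).
have e20 : 0 < e / 2 by rewrite divr_gt0.
have td0 : 0 <= t + delta by rewrite addr_ge0// ltW.
move: MN; rewrite addrA [e]splitr => MN.
have [mu [c [c0 muK muB]]] :=
  bowen_frostman cf m_le phi_le cX cK td0 (ltW d0) e20 Nsum MN.
exists mu; split => //; apply: ge0_integral_ge_cst => // x.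
rewrite local_BKE.
apply: (@le_trans _ _ (limn_einf (BK_quotient mu (e / 2) x))); last first.
  by apply: ereal_sup_ubound; exists (e / 2).
(* From [N1] on, [|ln c| <= delta * m * n <= delta * S n x], uniformly in [x]. *)
pose N1 := (Num.truncn (`|ln c| / (delta * m))).+1.
apply: (@limn_einf_ge _ _ _ (maxn N N1)) => n; rewrite geq_max => /andP[Nn N1n].
have n0 : (0 < n)%N by exact: leq_trans N1n.
rewrite BK_quotient_geE//; apply: le_trans (muB n x Nn) _.
rewrite lee_fin -{1}(lnK (c0 : c \is Num.pos)) -expRN -expRD ler_expR.
have Sn := ball_sup_ge phi_le (bowen_ball_center f alpha n x e20).
have Smn := birkhoff_ge f m_le n x.
have dmn : `|ln c| <= delta * m * n%:R.
  rewrite mulrC -ler_pdivrMr ?mulr_gt0//; apply: ltW.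
  apply: lt_le_trans (truncnS_gt _) _.
  by rewrite ler_nat.
have := ler_norm (- ln c); rewrite normrN => lnc.
have h1 : (t + delta) * S n x <= (t + delta) * ball_sup f phi alpha n x (e / 2).
  by rewrite ler_wpM2l.
have h2 : delta * (m * n%:R) <= delta * S n x by rewrite ler_wpM2l// ltW.
rewrite mulNr; lra.
Qed.

End bowen_dimension.

(** * The variational principle *)

Theorem theorem1p2 (R : realType) (X : pointedMetricType R) (f : X -> X) (phi : X -> R)
  (K : set X) :
  compact [set: X] ->
  continuous f ->
  continuous phi ->
  (forall x, 0 < phi x) ->
  compact K -> K !=set0 ->
  forall alpha : R, 0 <= alpha ->
  dim_BS f alpha K phi =
  ereal_sup [set BK_entropy mu f alpha phi
            | mu in [set mu : probability (@borel_of R X) R | mu K = 1%E]].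
Proof.
move=> cX cf cphi phi0 cK [x0 Kx0] alpha alpha0.
have X0 : [set: X] !=set0 by exists x0.
have wphi : {within [set: X], continuous phi} by exact: continuous_subspaceT.
have [a _ amin] := compact_EVT_min X0 cX wphi.
have [b _ bmax] := compact_EVT_max X0 cX wphi.
have m_le x : phi a <= phi x by apply: amin; rewrite inE.
have le_M x : phi x <= phi b by apply: bmax; rewrite inE.
have clK : closed K by apply: compact_closed cK; exact: metric_hausdorff.
apply/eqP; rewrite eq_le; apply/andP; split; last first.
  apply: ge_ereal_sup => _ [mu /= muK <-].
  by have := BK_entropy_le_dim cf (phi0 a) m_le le_M alpha0 cX cphi clK muK.
set s := (X in (_ <= X)%E).
have BK_le (mu : probability (@borel_of R X) R) :
    mu K = 1%E -> (BK_entropy mu f alpha phi <= s)%E.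
  by move=> muK; apply: ereal_sup_ubound; exists mu.
have s0 : (0 <= s)%E.
  (* A Dirac mass in [K] shows that the supremum is nonnegative, so that the exponent [t] chosen
     above it below is admissible in [exists_entropy_ge]. *)
  pose mu : probability (@borel_of R X) R := dirac (x0 : @borel_of R X).
  apply: (@le_trans _ _ (BK_entropy mu f alpha phi)).
    apply: integral_ge0 => x _; exact: (local_BK_ge0 alpha cf (phi0 a) m_le).
  by apply: BK_le; rewrite /= diracE mem_set.
rewrite leNgt; apply/negP; move: s s0 BK_le.
case=> [r||] r0 BK_le rdim; [|by move: rdim; rewrite ltNge leey|by []].
have [t rt tdim] : exists2 t, r < t & (t%:E < dim_BS f alpha K phi)%E.
  case: (dim_BS _ _ _ _) rdim => [d|_|//]; last by exists (r + 1); rewrite ?ltrDl ?ltry.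
  rewrite lte_fin => rd; exists ((r + d) / 2); rewrite ?lte_fin; lra.
have t0 : 0 <= t by apply: le_trans (ltW rt); rewrite -lee_fin.
have [mu [muK tmu]] := exists_entropy_ge cf (phi0 a) m_le le_M cX cK t0 tdim.
suff : (t%:E <= r%:E)%E by rewrite lee_fin leNgt rt.
exact: le_trans tmu (BK_le mu muK).
Qed.
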